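(* Let $n$ be even and let $C_n$ be the cycle with vertex set $\mathbb Z_n$ and edges $\{j,j+1\}$, $j\in\mathbb Z_n$, where the edges $\{0,n-1\}$ and $\{\frac n2,\frac n2+1\}$ have weight $-1$ and all other edges have weight $1$. This signed cycle exhibits pretty good state transfer between $\frac1{\sqrt2}(\mathbf e_a+\mathbf e_{n-a})$ and $\frac1{\sqrt2}(\mathbf e_{\frac n2-a}+\mathbf e_{\frac n2+a})$ whenever $0<a<\frac n2$, $a\ne\frac n4$, and either (1) $n=2^k$ for some integer $k>2$, or (2) $n=2^kp$ where $k$ is a positive integer and $p$ is an odd prime, and $a=2^{k-2}r$ for some positive integer $r$.
   Context: For a signed graph with adjacency matrix $A$ (entries the edge weights) and $U(t)=\exp(itA)$, there is pretty good state transfer between unit vectors $\mathbf u$ and $\mathbf v$ if there is a sequence of real times $\{\tau_k\}$ with $\lim_{k\to\infty}U(\tau_k)\mathbf u=\gamma\mathbf v$ for some $\gamma\in\mathbb C$. $\mathbf e_j$ is the standard basis vector of vertex $j$. *)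

(* Defs.v *)
From HB Require Import structures.
From mathcomp Require Import all_boot all_order all_algebra complex.
From mathcomp Require Import all_classical all_reals all_analysis.

Set Implicit Arguments.
Unset Strict Implicit.
Unset Printing Implicit Defensive.

Import Order.TTheory GRing.Theory Num.Theory numFieldNormedType.Exports.

Local Open Scope ring_scope.

(* R[i] itself carries no topology in the library; R[i]^o has the same
   elements and ring operations, and the topology of the complex modulus. *)
Definition exp_mx (R : realType) (m : nat) (M : 'M[R[i]^o]_m) :
    'M[R[i]^o]_m :=
  limn (series (fun k : nat => k`!%:R^-1 *: M ^+ k)).

Definition transition_mx (R : realType) (m : nat) (A : 'M[R]_m) (t : R) :
    'M[R[i]^o]_m :=
  exp_mx (Complex 0 t *: map_mx (real_complex R) A).

(* Intended for unit vectors u and v. *)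
Definition pretty_good_state_transfer (R : realType) (m : nat) (A : 'M[R]_m)
    (u v : 'cV[R[i]^o]_m) : Prop :=
  exists (tau : nat -> R) (gamma : R[i]^o),
    (transition_mx A (tau k) *m u @[k --> \oo] --> gamma *: v)%classic.

Definition std_basis (R : realType) (m : nat) (j : 'I_m) : 'cV[R[i]^o]_m :=
  delta_mx j 0.

(* A unit vector when j and k are distinct. *)
Definition pair_state (R : realType) (m : nat) (j k : 'I_m) :
    'cV[R[i]^o]_m :=
  real_complex R (Num.sqrt 2)^-1 *: (std_basis R j + std_basis R k).

(* 'Z_n is the ring of integers modulo n only when 1 < n. *)
Definition cycle_edge (n : nat) (i j : 'Z_n) : bool :=
  (j == i + 1) || (i == j + 1).

Definition negative_edge (n : nat) (i j : 'Z_n) : bool :=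
  ([set i; j] == [set 0; (n - 1)%N%:R]) ||
  ([set i; j] == [set (n %/ 2)%N%:R; (n %/ 2 + 1)%N%:R]).

Definition signed_cycle_adj (R : realType) (n : nat) :
    'M[R]_((Zp_trunc n).+2) :=
  \matrix_(i, j)
    (if cycle_edge i j then if negative_edge i j then -1 else 1 else 0).

(* Main.v *)
Require Import Defs.
From HB Require Import structures.
From mathcomp Require Import all_boot all_order all_algebra all_field complex.
From mathcomp Require Import all_classical all_reals all_analysis.
From mathcomp Require Import ring lra zify.

Import Order.TTheory GRing.Theory Num.Theory numFieldNormedType.Exports.

Local Open Scope ring_scope.

(** Conjugating by the sign switch that is -1 above n/2 turns the signed cycle
   into the unsigned one, so the characters of Z_n give spectral projectors B_j
   with eigenvalues 2 cos(2 pi j / n).  The source u and the target v satisfy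
   B_j v = - (-1)^j B_j u, hence transfer amounts to finding times t at which
   all the numbers e^{2 i t cos(2 pi j / n)} with B_j u <> 0 are close to w for
   odd j and to -w for even j, for one unit number w.  By Kronecker's theorem
   this is possible if every integer relation between the eigenvalues respects
   these phases.  A relation is an integer polynomial vanishing at a primitive
   n-th root of unity, so cyclotomic irreducibility, together with the
   indices j where B_j u = 0, forces the coefficients to have a period n/2 in
   the relevant parity class; the phases are then compatible for w = -1
   (n = 2^k), w = 1 (n = 2^k p, k > 1) and w = i (n = 2 p).

   Kronecker's theorem itself is obtained from even moments: the time average
   of |P|^(2N), for the trigonometric sum P of d aligned terms, is at least
   d^(2N) / (N+1)^d, so |P| comes arbitrarily close to d. *)

(** * Kronecker's theorem *)

(** Cauchy-Schwarz against the constant function 1: both sides are doubled and written as double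
    sums, then compared termwise by 2xy <= x^2 + y^2. *)
Lemma leq_sqr_sum_card (T : finType) (F : T -> nat) :
  ((\sum_x F x) ^ 2 <= #|T| * \sum_x F x ^ 2)%N.
Proof.
rewrite -(leq_pmul2l (isT : 0 < 2)%N) -mulnn big_distrlr /=.
have -> : (2 * (#|T| * \sum_x F x ^ 2) =
           \sum_x \sum_y (F x ^ 2 + F y ^ 2))%N.
  under [RHS]eq_bigr do rewrite big_split /= sum_nat_const.
  by rewrite big_split /= sum_nat_const -big_distrr /= addnn mul2n.
rewrite big_distrr /=; apply: leq_sum => x _; rewrite big_distrr /=.
by apply: leq_sum => y _; exact: nat_Cauchy.
Qed.

(** The fibre sizes of [h] sum to [#|X|] and their squares count the colliding pairs, so
    Cauchy-Schwarz applies. *)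
Lemma leq_card_fiber_pairs (X T : finType) (h : X -> T) :
  (#|X| ^ 2 <= #|T| * #|[set p : X * X | h p.1 == h p.2]|)%N.
Proof.
have -> : #|X| = (\sum_t #|[set x | h x == t]|)%N.
  rewrite -sum1_card (partition_big h predT) //=.
  by apply: eq_bigr => t _; rewrite -sum1_card; apply: eq_bigl => x; rewrite inE.
have -> : #|[set p : X * X | h p.1 == h p.2]| =
    (\sum_t #|[set x | h x == t]| ^ 2)%N.
  rewrite -sum1_card (partition_big (fun p => h p.1) predT) //=.
  apply: eq_bigr => t _; rewrite -mulnn -cardsX -sum1_card; apply: eq_bigl => p.
  by rewrite !inE; apply/andP/andP => -[/eqP e1 /eqP e2]; rewrite ?e1 ?e2 -?e1 -?e2 ?eqxx.
exact: leq_sqr_sum_card.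
Qed.

(** * Words of length [N] and their letter counts *)

Section Words.
Variables (I : finType) (N : nat).

(** A letter occurs at most [N] times, so [inord] loses nothing; the finite codomain shows that
    there are at most (N+1)^d contents for d letters. *)
Definition word_content (f : {ffun 'I_N -> I}) : {ffun I -> 'I_N.+1} :=
  [ffun i => inord #|[set k | f k == i]|].

Lemma prod_word (C : comNzRingType) (w : I -> C) (f : {ffun 'I_N -> I}) :
  \prod_k w (f k) = \prod_i w i ^+ word_content f i.
Proof.
rewrite (partition_big f predT) //=; apply: eq_bigr => i _.
rewrite (eq_bigr (fun=> w i)) => [|k /eqP -> //].
rewrite ffunE inordK ?ltnS; last by rewrite -[leqRHS]card_ord max_card.
by rewrite prodr_const; congr (_ ^+ _); apply: eq_card => k; rewrite !inE.
Qed.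

Lemma sum_word (V : zmodType) (th : I -> V) (f : {ffun 'I_N -> I}) :
  \sum_k th (f k) = \sum_i th i *+ word_content f i.
Proof.
rewrite (partition_big f predT) //=; apply: eq_bigr => i _.
rewrite (eq_bigr (fun=> th i)) => [|k /eqP -> //].
rewrite ffunE inordK ?ltnS; last by rewrite -[leqRHS]card_ord max_card.
by rewrite sumr_const; congr (_ *+ _); apply: eq_card => k; rewrite !inE.
Qed.

End Words.

(** The bound does not depend on [K], so such sums disappear from an average over a long time. *)
Lemma norm_geometric_sum (C : numFieldType) (x : C) (K : nat) :
  `|x| = 1 -> x != 1 -> `|\sum_(k < K) x ^+ k| <= 2 / `|x - 1|.
Proof.
move=> x1 xn1; rewrite ler_pdivlMr ?normr_gt0 ?subr_eq0 //.
rewrite -normrM mulrC -subrX1 (le_trans (ler_normB _ _)) //.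
by rewrite normrX x1 expr1n normr1.
Qed.

Lemma normr1_conj (C : numClosedFieldType) (x : C) : `|x| = 1 -> x * x^* = 1.
Proof. by move=> x1; rewrite -normCK x1 expr1n. Qed.

(** * Even moments of a trigonometric sum *)

Section Mean.
Variables (C : numClosedFieldType) (I : finType) (w tau : I -> C) (N : nat).
Hypothesis w1 : forall i, `|w i| = 1.
Hypothesis tau1 : forall i, `|tau i| = 1.

Let W (f : {ffun 'I_N -> I}) := \prod_k w (f k).
Let T (f : {ffun 'I_N -> I}) := \prod_k tau (f k).

Let W1 f : `|W f| = 1.
Proof. by rewrite normr_prod big1. Qed.
Let T1 f : `|T f| = 1.
Proof. by rewrite normr_prod big1. Qed.

Hypothesis WT : forall f g, W f = W g -> T f = T g.

Lemma trig_sum_exp k :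
  (\sum_i (tau i)^* * w i ^+ k) ^+ N = \sum_f (T f)^* * W f ^+ k.
Proof.
rewrite -[in LHS](card_ord N) -prodr_const bigA_distr_bigA /=.
apply: eq_bigr => f _; rewrite big_split /=; congr (_ * _).
  by rewrite rmorph_prod.
by rewrite prodrXl.
Qed.

Lemma trig_sum_exp_norm k :
  `|\sum_i (tau i)^* * w i ^+ k| ^+ N ^+ 2 =
  \sum_p (T p.1)^* * T p.2 * (W p.1 * (W p.2)^*) ^+ k.
Proof.
rewrite -normrX normCK trig_sum_exp rmorph_sum big_distrlr /=.
rewrite pair_big /=; apply: eq_bigr => p _.
rewrite rmorphM rmorphXn /= conjCK exprMn; ring.
Qed.

(** In the expansion over pairs of words, a pair with equal [W] also has equal [T], so it
    contributes exactly [K]. Every other pair gives a geometric sum with ratio different from 1,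
    bounded independently of [K]. *)
Lemma trig_sum_mean_lower K :
  K%:R * #|[set p | W p.1 == W p.2]|%:R <=
  \sum_(k < K) `|\sum_i (tau i)^* * w i ^+ k| ^+ N ^+ 2 +
  \sum_(p | W p.1 != W p.2) 2 / `|W p.1 * (W p.2)^* - 1|.
Proof.
under eq_bigr do rewrite trig_sum_exp_norm.
rewrite exchange_big /= (bigID (fun p => W p.1 == W p.2)) /=.
rewrite [X in X + _ + _](_ : _ = K%:R * #|[set p | W p.1 == W p.2]|%:R); last first.
  rewrite (eq_bigr (fun=> K%:R)) => [|p /eqP e].
    rewrite sumr_const [RHS]mulr_natr; congr (_ *+ _).
    by apply: eq_card => p; rewrite inE.
  rewrite -mulr_sumr e (WT _ _ e) [(T _)^* * _]mulrC (normr1_conj _ (T _)) // mul1r.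
  under eq_bigr do rewrite normr1_conj // expr1n.
  by rewrite sumr_const card_ord.
rewrite -addrA lerDl.
set A := \sum_(p | _) \sum_(k < K) _; set B := \sum_(p | _) (2 / _).
have leAB : `|A| <= B.
  apply: le_trans (ler_norm_sum _ _ _) _; apply: ler_sum => p np.
  rewrite -mulr_sumr !normrM norm_conjC !T1 !mul1r norm_geometric_sum //.
    by rewrite normrM norm_conjC !W1 mulr1.
  apply: contra np => /eqP e; apply/eqP.
  by rewrite -[LHS]mulr1 -(normr1_conj _ (W p.2)) // [W p.2 * _]mulrC mulrA e mul1r.
(* The order of [C] is partial, so comparing [- A] with its modulus requires [A] to be real; it is
   the difference of the real total and the real diagonal part. *)
have rA : A \is Num.real.
  have : \sum_(k < K) `|\sum_i (tau i)^* * w i ^+ k| ^+ N ^+ 2 \is Num.real.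
    by apply: rpred_sum => k _; rewrite !rpredX // normr_real.
  under eq_bigr do rewrite trig_sum_exp_norm.
  rewrite exchange_big /= (bigID (fun p => W p.1 == W p.2)) /= -/A.
  set D := (X in X + A); have rD : D \is Num.real.
    apply: rpred_sum => p /eqP e; apply: rpred_sum => k _.
    rewrite e (WT _ _ e) [(T _)^* * _]mulrC !normr1_conj //.
    by rewrite expr1n mulr1 rpred1.
  by move=> h; rewrite -[A](addKr D) rpredD ?rpredN.
rewrite -lerBlDl sub0r; apply: le_trans leAB.
by rewrite -normrN real_ler_norm ?rpredN.
Qed.

End Mean.

(** With [N] = (d+1)M, Bernoulli's inequality gives y^N >= (M del)^(d+1), while (N+1)^d <=
    ((d+2)M)^d. The first bound has one more factor M, and M is taken large enough for it to win. *)
Lemma exp_dominates_poly (R : archiRealFieldType) (y : R) (d : nat) :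
  1 < y -> exists N : nat, (N.+1 ^ d)%:R < y ^+ N.
Proof.
move=> y1; set del := y - 1; have del0 : 0 < del by rewrite subr_gt0.
pose M := (Num.bound ((d.+2 ^ d)%:R / del ^+ d.+1)).+1.
exists (d.+1 * M)%N; rewrite mulnC exprM.
have bernoulli : M%:R * del <= y ^+ M.
  have -> : y = 1 + del by rewrite addrC subrK.
  elim: (M) => [|k IH]; first by rewrite mul0r.
  rewrite exprS -natr1 mulrDl mul1r mulrDl mul1r lerD //.
  by rewrite ler_peMr ?(ltW del0) // exprn_ege1 ?lerDl ?(ltW del0) // addr_ge0 ?ler01 ?(ltW del0).
have : (M%:R * del) ^+ d.+1 <= (y ^+ M) ^+ d.+1.
  by rewrite lerXn2r ?nnegrE ?exprn_ge0 ?mulr_ge0 ?ler0n ?(ltW del0) ?(ltW (lt_trans ltr01 y1)).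
apply: lt_le_trans.
have M0 : 0 < M%:R :> R by rewrite ltr0n.
apply: (@le_lt_trans _ _ ((d.+2 * M) ^ d)%:R).
  rewrite ler_nat; case: (d) => // d'; rewrite leq_exp2r //; lia.
rewrite expnMn natrM exprMn natrX [X in _ < X * _]exprS.
have : (d.+2 ^ d)%:R / del ^+ d.+1 < M%:R.
  apply: (lt_le_trans (archi_boundP _)).
    by rewrite divr_ge0 ?ler0n ?exprn_ge0 ?(ltW del0).
  by rewrite ler_nat.
rewrite ltr_pdivrMr ?exprn_gt0 // => h.
rewrite natrX in h; rewrite !natrX.
rewrite mulrC [X in _ < X](_ : _ = M%:R ^+ d * (M%:R * del ^+ d.+1)); last by ring.
by rewrite ltr_pM2l ?exprn_gt0.
Qed.

(* A sum of d unit complex numbers containing 1 and w has modulus at most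
   d - 2 + |1 + w|, and |1 + w|^2 = 4 - |1 - w|^2. *)
Lemma norm_sum_unit_le (R : realType) (I : finType) (i0 i1 : I) (w : I -> R[i]) (e : R) :
  (forall i, `|w i| = 1) -> w i0 = 1 -> 0 < e -> e <= 2 -> e%:C%C <= `|w i1 - 1| ->
  `|\sum_i w i| <= (#|I|%:R - 2 + Num.sqrt (4 - e ^+ 2))%:C%C.
Proof.
move=> w1 wi0 e0 e2 ew.
have i01 : i1 != i0.
  apply: contraTneq ew => ->; rewrite wi0 subrr normr0 -[0]/(0%:C%C) lecR.
  by rewrite -ltNge.
rewrite (bigD1 i0) //= (bigD1 i1) //= wi0 addrA.
apply: le_trans (ler_normD _ _) _; rewrite [leLHS]addrC [leRHS]rmorphD; apply: lerD.
  apply: le_trans (ler_norm_sum _ _ _) _.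
  rewrite (eq_bigr (fun=> 1)) => [|i _]; last exact: w1.
  rewrite sumr_const rmorphB /= !rmorph_nat lerBrDr -natrD ler_nat.
  rewrite -[#|I|]cardsT (cardsD1 i0) (cardsD1 i1) !inE i01 /= addnC addnA leq_add2l.
  by apply/subset_leq_card/fintype.subsetP => i; rewrite !inE andbT [_ \in _]/= => /andP[-> ->].
set s := Num.sqrt _.
have s0 : 0 <= 4 - e ^+ 2 by nra.
rewrite -[leRHS]/(s%:C%C) -(@ler_pXn2r _ 2) ?nnegrE ?normr_ge0 //; last by rewrite ler0c sqrtr_ge0.
have -> : s%:C%C ^+ 2 = 4 - e%:C%C ^+ 2.
  rewrite -(rmorphXn (real_complex R)) (sqr_sqrtr s0).
  by rewrite rmorphB rmorphXn /= rmorph_nat.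
have -> : `|1 + w i1| ^+ 2 = 4 - `|w i1 - 1| ^+ 2.
  rewrite !normCK rmorphD rmorphB rmorph1 /=.
  have := normr1_conj _ _ (w1 i1).
  set x := w i1; set y := x^* => xy.
  rewrite [(1 + x) * _](_ : _ = 1 + x * y + (x + y)); last by ring.
  rewrite [(x - 1) * _](_ : _ = 1 + x * y - (x + y)); last by ring.
  by rewrite xy; ring.
by rewrite lerB // lerXn2r ?nnegrE // ler0c ltW.
Qed.

(** If some coordinate were far at every [k], the trigonometric sum would stay below a constant c <
    d, so the number of colliding pairs of words would be at most c^(2N). Counting contents gives at
    least d^(2N) / (N+1)^d, a contradiction for large [N]. The index [i0], fixed at 1, rules out a
    common rotation of all terms. Since [N] is chosen before [w], the time scale may later depend on
    [N]. *)
Lemma torus_kronecker (R : realType) (I : finType) (i0 : I) (eps : R) :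
  0 < eps -> exists N : nat, forall w tau : I -> R[i],
    (forall i, `|w i| = 1) -> (forall i, `|tau i| = 1) ->
    w i0 = 1 -> tau i0 = 1 ->
    (forall f g : {ffun 'I_N -> I},
       \prod_k w (f k) = \prod_k w (g k) ->
       \prod_k tau (f k) = \prod_k tau (g k)) ->
  exists k : nat, forall i, `|w i ^+ k - tau i| < eps%:C%C.
Proof.
(* Capping the tolerance at 1 makes the square root in [c] exceed 1, so that [c] is positive even
   when [d] is 1. *)
move=> eps0; pose e := Num.min eps 1; set d := #|I|.
have e0 : 0 < e by rewrite lt_min eps0 ltr01.
have e1 : e <= 1 by rewrite ge_min lexx orbT.
have ee0 : 0 < e ^+ 2 by rewrite exprn_gt0.
have ee1 : e ^+ 2 <= 1 by rewrite exprn_ile1 // ltW.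
pose c := d%:R - 2 + Num.sqrt (4 - e ^+ 2).
have d1 : 1 <= d%:R :> R by rewrite ler1n; apply/card_gt0P; exists i0.
have c0 : 0 < c.
  have : 1 < Num.sqrt (4 - e ^+ 2) by rewrite -[ltLHS]sqrtr1 ltr_sqrt; lra.
  rewrite /c; lra.
have cd : c < d%:R.
  have : Num.sqrt (4 - e ^+ 2) < 2.
    have -> : 2 = Num.sqrt (2 ^+ 2) :> R by rewrite sqrtr_sqr ger0_norm.
    by rewrite ltr_sqrt ?exprn_gt0 //; lra.
  rewrite /c; lra.
have [|N hN] := @exp_dominates_poly R ((d%:R / c) ^+ 2) d.
  by rewrite exprn_egt1 // ltr_pdivlMr // mul1r.
exists N => w tau w1 tau1 wi0 taui0 wt.
apply/not_existsP => far.
have small k : `|\sum_i (tau i)^* * w i ^+ k| <= c%:C%C.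
  have /existsNP[i /negP] := far k.
  have v1 j : `|(tau j)^* * w j ^+ k| = 1.
    by rewrite normrM norm_conjC tau1 normrX w1 expr1n mulr1.
  have -> : w i ^+ k - tau i = tau i * ((tau i)^* * w i ^+ k - 1).
    by rewrite mulrBr mulrA normr1_conj // mul1r mulr1.
  rewrite normrM tau1 mul1r -real_leNgt ?normr_real ?complex_real //= => h.
  apply: (@norm_sum_unit_le R I i0 i) => //.
  - by rewrite taui0 wi0 expr1n rmorph1 mulr1.
  - by lra.
  - by apply: le_trans h; rewrite lecR ge_min lexx.
set S := #|[set p : {ffun 'I_N -> I} * {ffun 'I_N -> I} |
             \prod_k w (p.1 k) == \prod_k w (p.2 k)]|.
(* Otherwise the main term would grow linearly in [K], whereas the off-diagonal bound [B] is
   fixed. *)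
have leS : S%:R <= (c ^+ N) ^+ 2.
  rewrite leNgt; apply/negP => ltS.
  set B := \sum_(p : {ffun 'I_N -> I} * {ffun 'I_N -> I} |
             \prod_k w (p.1 k) != \prod_k w (p.2 k))
             2 / `|\prod_k w (p.1 k) * (\prod_k w (p.2 k))^* - 1|.
  have hK K : K%:R * (S%:R - (c ^+ N) ^+ 2) <= complex.Re B.
    have := @trig_sum_mean_lower _ I w tau N w1 tau1 wt K; rewrite -/S -/B => h.
    have : (K%:R * (S%:R - (c ^+ N) ^+ 2))%:C%C <= B.
      rewrite rmorphM rmorphB !rmorphXn /= !rmorph_nat mulrBr lerBlDl.
      apply: le_trans h _; rewrite lerD2r.
      rewrite -[K in leRHS]card_ord mulr_natl -sumr_const; apply: ler_sum => k _.
      by rewrite !lerXn2r ?nnegrE ?exprn_ge0 ?normr_ge0 // ler0c ltW.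
    by rewrite lecE => /andP[].
  have := hK (Num.bound (complex.Re B / (S%:R - (c ^+ N) ^+ 2))).
  apply/negP; rewrite -ltNge -ltr_pdivrMr ?subr_gt0 //; apply: archi_boundP.
  by rewrite divr_ge0 ?subr_ge0 ?(ltW ltS) //; have := hK 0%N; rewrite mul0r.
have hS : ((d ^ N) ^ 2 <= N.+1 ^ d * S)%N.
  have := leq_card_fiber_pairs _ _ (@word_content I N).
  rewrite !card_ffun !card_ord => h; apply: (leq_trans h).
  rewrite leq_mul2l; apply/orP; right; apply/subset_leq_card/fintype.subsetP => p.
  by rewrite !inE => /eqP e'; rewrite !prod_word e'.
suff : (N.+1 ^ d)%:R * (c ^+ N) ^+ 2 < (d%:R ^+ N) ^+ 2.
  apply/negP; rewrite -leNgt -!natrX; apply: le_trans (_ : _ <= (N.+1 ^ d * S)%:R) _.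
    by rewrite ler_nat.
  by rewrite natrM ler_wpM2l.
rewrite -ltr_pdivlMr ?exprn_gt0 //.
by rewrite -!exprM -expr_div_n mulnC exprM.
Qed.

(** * Points of the unit circle and Kronecker's theorem in real time *)

Definition cis (R : realType) (x : R) : R[i] := Complex (cos x) (sin x).

Lemma cis0 (R : realType) : cis R 0 = 1.
Proof. by rewrite /cis cos0 sin0. Qed.

Lemma cisD (R : realType) (x y : R) : cis R (x + y) = cis R x * cis R y.
Proof.
rewrite /cis cosD sinD; apply/eqP; rewrite eq_complex /=.
by rewrite [sin x * _ + _]addrC !eqxx.
Qed.

Lemma cisMn (R : realType) (x : R) (n : nat) : cis R (x *+ n) = cis R x ^+ n.
Proof.
by elim: n => [|n IH]; rewrite ?mulr0n ?cis0 // mulrS cisD IH exprS.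
Qed.

Lemma norm_cis (R : realType) (x : R) : `|cis R x| = 1.
Proof. by rewrite normc_def /= cos2Dsin2 sqrtr1. Qed.

Lemma cis_sum (R : realType) (I : finType) (F : I -> R) :
  cis R (\sum_i F i) = \prod_i cis R (F i).
Proof. by apply: (big_morph (cis R)); [exact: cisD | exact: cis0]. Qed.

Lemma cis_eq1 (R : realType) (x : R) : `|x| < 1 -> cis R x = 1 -> x = 0.
Proof.
move=> x1 [_ sx]; apply/eqP; apply: contraTT isT => x0.
have pi2 := @pi_ge2 R.
have /sin_gt0_pi : 0 < `|x| < pi by rewrite normr_gt0 x0 (lt_trans x1) //; lra.
by case: (ger0P x) => _; rewrite ?sinN sx ?oppr0 ltxx.
Qed.

(* Scaling the time by a small s makes the finitely many frequency differences
   of words of length N smaller than 1, so that multiplicative relations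
   between the numbers cis (s th_i) are additive relations between the th_i. *)
Lemma kronecker (R : realType) (I : finType) (i0 : I) (th : I -> R)
    (tau : I -> R[i]) (eps : R) :
  0 < eps -> th i0 = 0 -> tau i0 = 1 -> (forall i, `|tau i| = 1) ->
  (forall c c' : I -> nat, \sum_i th i *+ c i = \sum_i th i *+ c' i ->
     \prod_i tau i ^+ c i = \prod_i tau i ^+ c' i) ->
  exists t : R, forall i, `|cis R (t * th i) - tau i| < eps%:C%C.
Proof.
move=> eps0 th0 tau0 tau1 rel.
have [N hN] := @torus_kronecker R I i0 eps eps0.
pose dl (p : {ffun 'I_N -> I} * {ffun 'I_N -> I}) :=
  \sum_k th (p.1 k) - \sum_k th (p.2 k).
(* [M] exceeds every [|dl p|], so the scaled differences lie in the range where [cis_eq1]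
   applies. *)
pose M := 1 + \sum_p `|dl p|.
have M0 : 0 < M by rewrite ltr_pwDl // sumr_ge0.
have [] := hN (fun i => cis R (M^-1 * th i)) tau.
- by move=> i; exact: norm_cis.
- by [].
- by rewrite th0 mulr0 cis0.
- by [].
- move=> f g; rewrite -!cis_sum -!mulr_sumr => efg.
  have : dl (f, g) = 0.
    have : cis R (M^-1 * dl (f, g)) = 1.
      apply: (@mulIf _ (cis R (M^-1 * \sum_k th (g k)))).
        by rewrite -normr_eq0 norm_cis oner_eq0.
      by rewrite -cisD -mulrDr subrK mul1r.
    move/cis_eq1 => h; apply/eqP; rewrite -(mulrI_eq0 _ (mulfI (invr_neq0 (lt0r_neq0 M0)))).
    apply/eqP/h; rewrite normrM ger0_norm ?invr_ge0 ?(ltW M0) //.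
    rewrite mulrC ltr_pdivrMr // mul1r /M (bigD1 (f, g)) //= addrCA ltrDl.
    by rewrite ltr_pwDl // sumr_ge0.
  move/eqP; rewrite subr_eq0 /= => /eqP; rewrite !sum_word => /rel.
  by rewrite !prod_word.
move=> k hk; exists (M^-1 *+ k) => i.
by have := hk i; rewrite -cisMn mulrnAl.
Qed.

(** * Exponential of a diagonalizable matrix *)

Section Exponential.
Local Open Scope classical_set_scope.

(** The modulus of a complex number is at most the sum of the absolute values of its two parts. *)
Lemma cvg_complex (R : realType) (u v : nat -> R) (a b : R) :
  u @ \oo --> a -> v @ \oo --> b ->
  (Complex (u n) (v n) : R[i]^o) @[n --> \oo] --> (Complex a b : R[i]^o).
Proof.
move=> /cvgrPdist_lt ua /cvgrPdist_lt vb; apply/cvgrPdist_lt => e e0.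
have [er ee er0] : exists2 r, e = r%:C%C & 0 < r.
  have /complex_realP[r er] : e \is Num.real by rewrite realE ltW.
  by exists r => //; rewrite -ltcR -er.
have e20 : 0 < er / 2 by rewrite divr_gt0.
near=> n.
rewrite ee (_ : _ - _ = (a - u n)%:C%C + (b - v n)%:C%C * 'i%C); last first.
  apply/eqP; rewrite eq_complex /= !(mul0r, mulr0, addr0, add0r, mulr1, subr0).
  by rewrite !eqxx.
apply: le_lt_trans (ler_normD _ _) _.
rewrite normrM.
have -> : `|'i%C : R[i]| = 1 by rewrite normc_def /= expr0n expr1n add0r sqrtr1.
have nrm (r : R) : `|(r%:C%C : R[i])| = `|r|%:C%C.
  by rewrite normc_def /= expr0n addr0 sqrtr_sqr.
rewrite mulr1 !nrm -rmorphD ltcR.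
rewrite [er]splitr ltrD //; near: n; [exact: ua|exact: vb].
Unshelve. all: by end_near. Qed.

Lemma exp_coeff_imaginary (R : realType) (x : R) (k : nat) :
  k`!%:R^-1 * (Complex 0 x) ^+ k = Complex (cos_coeff x k) (sin_coeff x k) :> R[i].
Proof.
have -> : Complex 0 x = x%:C%C * 'i%C.
  by apply/eqP; rewrite eq_complex /= !(mul0r, mulr0, mulr1, addr0, subr0) !eqxx.
rewrite exprMn -rmorphXn -(rmorph_nat (real_complex R)) -fmorphV mulrA -rmorphM /=.
rewrite /cos_coeff /sin_coeff /=.
have -> : ('i%C : R[i]) ^+ k =
    Complex ((~~ odd k)%:R * (-1) ^ k./2) ((odd k)%:R * (-1) ^+ k.-1./2).
  (* The halves of k - 1 and k agree for odd k, and the factor is 0 for even k. *)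
  have -> : (odd k)%:R * (-1) ^+ k.-1./2 = (odd k)%:R * (-1) ^+ k./2 :> R.
    by case: k => //= k; case: (boolP (odd k)); rewrite ?mul0r // uphalf_half => /negbTE ->.
  rewrite -[in LHS](odd_double_half k) addnC exprD -mul2n exprM sqr_i.
  have -> : (-1) ^+ k./2 = ((-1) ^+ k./2)%:C%C :> R[i].
    by rewrite rmorphXn rmorphN1.
  apply/eqP; rewrite eq_complex; case: (odd k) => /=.
    by rewrite !(mul0r, mulr0, mul1r, mulr1, subr0, addr0) !eqxx.
  by rewrite !(mul0r, mulr0, mul1r, mulr1, subr0, addr0) !eqxx.
apply/eqP; rewrite eq_complex /= !(mul0r, subr0, addr0).
by apply/andP; split; apply/eqP; ring.
Qed.

Lemma cvg_exp_series_imaginary (R : realType) (x : R) :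
  series (fun k => k`!%:R^-1 * (Complex 0 x : R[i]^o) ^+ k) @ \oo --> (cis R x : R[i]^o).
Proof.
rewrite (_ : series _ = fun n => Complex (series (cos_coeff x) n) (series (sin_coeff x) n)).
  apply: cvg_complex.
    by rewrite cos.unlock; exact: is_cvg_series_cos_coeff.
  by rewrite sin.unlock; exact: is_cvg_series_sin_coeff.
apply/funext => n; elim: n => [|n IH]; first by rewrite /series /= !big_geq.
by rewrite !seriesSr IH [X in _ + X]exp_coeff_imaginary.
Qed.

Lemma cvg_sum_fin (K : numFieldType) (V : normedModType K) (I : finType)
    (u : I -> nat -> V) (l : I -> V) :
  (forall i, u i n @[n --> \oo] --> l i) ->
  (\sum_i u i n) @[n --> \oo] --> \sum_i l i.
Proof.
by move=> ul; apply: cvg_big => // p; exact: add_continuous.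
Qed.

(** Multiplying each power of [M] by [1], written as the sum of the [B j], turns the matrix series
    into a finite sum of scalar exponential series. *)
Lemma exp_mx_spectral (R : realType) (m : nat) (I : finType) (M : 'M[R[i]^o]_m.+1)
    (B : I -> 'M[R[i]^o]_m.+1) (x : I -> R) :
  \sum_j B j = 1 -> (forall j, M * B j = (Complex 0 (x j) : R[i]^o) *: B j) ->
  exp_mx M = \sum_j (cis R (x j) : R[i]^o) *: B j.
Proof.
move=> B1 MB; rewrite /exp_mx; apply: cvg_lim; first exact: norm_hausdorff.
have MkB k j : M ^+ k * B j = (Complex 0 (x j) : R[i]^o) ^+ k *: B j.
  elim: k => [|k IH]; first by rewrite !expr0 mul1r scale1r.
  by rewrite exprSr -mulrA MB -scalerAr IH scalerA -exprS.
rewrite (_ : series _ = fun n => \sum_j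
    series (fun k => k`!%:R^-1 * (Complex 0 (x j) : R[i]^o) ^+ k) n *: B j).
  by apply: cvg_sum_fin => j; apply: cvgZr_tmp; exact: cvg_exp_series_imaginary.
apply/funext => n; under eq_bigr do rewrite /series /= scaler_suml.
rewrite exchange_big /= /series /=; apply: eq_bigr => k _.
rewrite -[M ^+ k]mulr1 -B1 mulr_sumr scaler_sumr; apply: eq_bigr => j _.
by rewrite MkB scalerA.
Qed.

End Exponential.

(** * Integer relations between roots of unity *)

(** A common root in [C] shows that [f] and ['Phi_n] are not coprime over the rationals, hence they
    share a root in [algC]. Its minimal polynomial has degree [totient n] and divides [f], which is
    too short unless zero. *)
Lemma vanishing_int_poly (C : numFieldType) (n : nat) (z : C) (f : {poly int}) :
  n.-primitive_root z -> (size f <= totient n)%N ->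
  root (map_poly intr f) z -> f = 0.
Proof.
move=> pz sf fz; have n0 := prim_order_gt0 pz.
have intr_ratr (F : numFieldType) (g : {poly int}) :
    map_poly intr g = map_poly (ratr : rat -> F) (map_poly intr g).
  by rewrite -map_poly_comp; apply: eq_map_poly => b; rewrite /= ratr_int.
(* As a root of X^n - 1, [z] is a root of some ['Phi_d] with d dividing n; then z^d = 1 and
   primitivity give d = n. *)
have Phiz : root (map_poly (intr : int -> C) 'Phi_n) z.
  have : root (map_poly (intr : int -> C) (\prod_(d <- divisors n) 'Phi_d)) z.
    rewrite prod_Cyclotomic // rmorphB rmorph1 /= map_polyXn /root !hornerE.
    by rewrite prim_expr_order // subrr.
  rewrite rmorph_prod /root horner_prod prodf_seq_eq0 /= => /hasP[d].
  rewrite -dvdn_divisors // => dn rd.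
  have d0 := dvdn_gt0 n0 dn.
  have : z ^+ d = 1.
    have : root (map_poly (intr : int -> C) (\prod_(d' <- divisors d) 'Phi_d')) z.
      rewrite rmorph_prod /root horner_prod prodf_seq_eq0 /=; apply/hasP; exists d => //.
      by rewrite -dvdn_divisors.
    rewrite prod_Cyclotomic // rmorphB rmorph1 /= map_polyXn /root !hornerE.
    by rewrite subr_eq0 => /eqP.
  move/eqP; rewrite -(prim_order_dvd pz) => nd.
  by have -> : n = d by apply/eqP; rewrite eqn_dvd nd dn.
have [w pw] := C_prim_root_exists n0.
have ncop : ~~ coprimep (map_poly (intr : int -> rat) f) (map_poly intr 'Phi_n).
  rewrite -(coprimep_map (@ratr C)) -!intr_ratr.
  by apply: contraL Phiz => /coprimep_root /(_ fz).
have : ~~ coprimep (map_poly (intr : int -> algC) f) (map_poly intr 'Phi_n).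
  by rewrite !(intr_ratr algC) coprimep_map.
rewrite coprimep_def => /closed_rootP[x].
rewrite root_gcd => /andP[fx]; rewrite (Cintr_Cyclotomic pw).
rewrite root_cyclotomic // => px.
have [g [Dg _] dvg] := minCpolyP x.
move: fx; rewrite intr_ratr dvg => gf.
have sg : size g = (totient n).+1.
  by rewrite -(size_map_poly (ratr : {rmorphism rat -> algC})) -Dg
    (minCpoly_cyclotomic px) size_cyclotomic.
apply/eqP; apply: contraLR sf => f0; rewrite -ltnNge -sg.
have sE : size (map_poly (intr : int -> rat) f) = size f.
  by rewrite size_map_inj_poly //; exact: intr_inj.
by rewrite -sE dvdp_leq // -size_poly_eq0 sE size_poly_eq0.
Qed.

Lemma vanishing_int_sum (C : numFieldType) (n N : nat) (z : C) (c : nat -> int) :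
  n.-primitive_root z -> (N <= totient n)%N ->
  \sum_(j < N) (c j)%:~R * z ^+ j = 0 -> forall j, (j < N)%N -> c j = 0.
Proof.
move=> pz NT c0 j jN; pose f := \poly_(i < N) c i.
have : f = 0.
  apply: (vanishing_int_poly _ _ _ _ pz).
    exact: leq_trans (size_poly _ _) NT.
  rewrite /root (@horner_coef_wide _ N); last first.
    exact: leq_trans (size_poly _ _) (size_poly _ _).
  rewrite -[X in _ == X]c0; apply/eqP; apply: eq_bigr => i _.
  by rewrite coef_map /= coef_poly ltn_ord.
by move/(congr1 (fun p : {poly int} => p`_j)); rewrite coef_poly jN coef0.
Qed.

(** Reversing the range 0..N and cancelling the equal end terms realizes j -> -j modulo [N] on
    natural numbers. *)
Lemma sum_mirror (V : zmodType) (N : nat) (h : nat -> V) :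
  h 0 = h N -> \sum_(j < N) h (N - j)%N = \sum_(j < N) h j.
Proof.
move=> h0; have : \sum_(j < N.+1) h j = \sum_(j < N.+1) h (N - j)%N.
  by rewrite (reindex_inj rev_ord_inj) /=; apply: eq_bigr => j _; rewrite subSS.
by rewrite !big_ord_recr /= subnn h0 => /addIr.
Qed.

Lemma sum_blocks (V : zmodType) (H p : nat) (F : nat -> V) :
  \sum_(j < H * p) F j = \sum_(i < p) \sum_(b < H) F (H * i + b)%N.
Proof.
elim: p => [|p IH]; first by rewrite muln0 !big_ord0.
by rewrite mulnS addnC big_split_ord /= IH big_ord_recr.
Qed.

(* The n-th cyclotomic polynomial for n = 2 * 2 ^ h * p is
   \sum_(i < p) (- X^(2 ^ h)) ^+ i. *)
Lemma vanishing_sum_alternates (C : numFieldType) (h p : nat) (z : C) (d : nat -> int) :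
  prime p -> odd p -> (2 * (2 ^ h * p)).-primitive_root z ->
  \sum_(j < 2 ^ h * p) (d j)%:~R * z ^+ j = 0 ->
  forall j, (j < 2 ^ h * p)%N ->
    d j = (-1) ^+ (j %/ 2 ^ h) * d (j %% 2 ^ h + 2 ^ h * p.-1)%N.
Proof.
move=> pp op pz d0; set H := (2 ^ h)%N in pz d0 *.
have H0 : (0 < H)%N by rewrite expn_gt0.
have p0 := prime_gt0 pp.
(* [e] is the multiple of the cyclotomic polynomial that agrees with [d] on the top block, p - 1
   being even. What remains of [d] has degree below [H * p.-1], the totient of the order of [z], so
   it vanishes. *)
pose e j : int := (-1) ^+ (j %/ H) * d (j %% H + H * p.-1)%N.
pose c j : int := d j - e j.
have clast j : (H * p.-1 <= j)%N -> (j < H * p)%N -> c j = 0.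
  move=> j1 j2; have jH : (j %/ H)%N = p.-1 by nia.
  rewrite /c /e jH -signr_odd.
  have -> : odd p.-1 = false by lia.
  by rewrite expr0 mul1r {1}(divn_eq j H) jH mulnC addnC subrr.
have cz : \sum_(j < H * p.-1) (c j)%:~R * z ^+ j = 0.
  transitivity (\sum_(j < H * p) (c j)%:~R * z ^+ j).
    rewrite (big_ord_widen (H * p) (fun j => (c j)%:~R * z ^+ j));
      last by rewrite leq_mul2l leq_pred orbT.
    rewrite [RHS](bigID (fun j : 'I_(H * p) => (j < H * p.-1)%N)) /=.
    rewrite [X in _ = _ + X]big1 ?addr0 // => j.
    by rewrite -leqNgt => /clast -> //; rewrite mul0r.
  under eq_bigr do rewrite /c rmorphB mulrBl.
  rewrite sumrB d0 sub0r; apply/eqP; rewrite oppr_eq0; apply/eqP.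
  rewrite (sum_blocks _ H p (fun j => (e j)%:~R * z ^+ j)).
  rewrite (eq_bigr (fun i : 'I_p => (- z ^+ H) ^+ i *
             \sum_(b < H) (d (b + H * p.-1)%N)%:~R * z ^+ b)) => [|i _].
    rewrite -mulr_suml; suff -> : \sum_(i < p) (- z ^+ H) ^+ i = 0 by rewrite mul0r.
    have zHp : z ^+ (H * p) = -1.
      have : z ^+ (H * p) ^+ 2 == 1 by rewrite -exprM mulnC (prim_expr_order pz).
      rewrite sqrf_eq1 => /orP[|/eqP //].
      rewrite -(prim_order_dvd pz) => /dvdn_leq; nia.
    (* The geometric sum times 1 + z^H equals 1 + z^(Hp) = 0, since p is odd, so it remains to
       cancel this factor. *)
    have zH1 : 1 + z ^+ H != 0.
      apply/eqP => /eqP; rewrite addrC addr_eq0 => /eqP zH.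
      have : z ^+ (H * 2) == 1 by rewrite exprM zH sqrrN expr1n.
      rewrite -(prim_order_dvd pz) => /dvdn_leq.
      have := prime_gt1 pp; nia.
    apply: (mulfI zH1); rewrite mulr0.
    have := subrX1 (- z ^+ H) p.
    rewrite exprNn -exprM zHp -signr_odd op expr1 mulrNN mulr1 subrr.
    rewrite -opprD mulNr => /eqP; rewrite eq_sym oppr_eq0 => /eqP.
    by rewrite [1 + _]addrC.
  rewrite mulr_sumr; apply: eq_bigr => b _.
  rewrite /e [(H * i)%N]mulnC divnMDl // divn_small // addn0 modnMDl modn_small //.
  rewrite rmorphM rmorphXn rmorphN1 [(- z ^+ H) ^+ i]exprNn exprD.
  by rewrite [(i * H)%N]mulnC exprM; ring.
move=> j jHp; apply/eqP; rewrite -subr_eq0; apply/eqP; rewrite -/(e j) -/(c j).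
have [jl|] := ltnP j (H * p.-1); last by move/clast; exact.
apply: (vanishing_int_sum _ _ _ _ _ pz _ cz j jl).
rewrite mulnA -expnS totient_coprime; last first.
  by rewrite coprimeXl // coprime2n.
by rewrite totient_pfactor // totient_prime // mul1n.
Qed.

Lemma primitive_root_neq0 (C : fieldType) (n : nat) (z : C) :
  n.-primitive_root z -> z != 0.
Proof.
move=> pz; apply/eqP => z0; have := prim_expr_order pz.
by rewrite z0 expr0n gtn_eqF ?(prim_order_gt0 pz) // => /eqP; rewrite eq_sym oner_eq0.
Qed.

(** * Relations folded along the symmetry j -> -j *)

Section SymmetrizedCoefficients.
Variables (m : nat) (l : nat -> int).
Hypothesis l0 : l 0%N = l (2 * m)%N.

(** The indices j and 2m - j carry the same eigenvalue, so a relation constrains only this sum of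
    coefficients. *)
Definition sym_coef (j : nat) : int := l j + l (2 * m - j)%N.

Lemma sym_coef_mirror j : (j <= 2 * m)%N -> sym_coef (2 * m - j)%N = sym_coef j.
Proof. by move=> jn; rewrite /sym_coef subKn // addrC. Qed.

Variable P : pred nat.
Hypothesis Pm : forall j, P (j + m)%N = P j.
Hypothesis PN : forall j, (j <= 2 * m)%N -> P (2 * m - j)%N = P j.
Hypothesis periodic : forall j, (j < m)%N -> P j -> sym_coef j = sym_coef (j + m)%N.

(** By reflection the sum of [sym_coef] over a full period is twice the left side; by periodicity it
    is twice the right side. *)
Lemma sum_coef_half : \sum_(j < 2 * m | P j) l j = \sum_(j < m | P j) sym_coef j.
Proof.
apply: (@mulfI _ 2) => //; transitivity (\sum_(j < 2 * m | P j) sym_coef j).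
  rewrite /sym_coef big_split /= mulr2n mulrDl mul1r; congr (_ + _).
  rewrite [LHS]big_mkcond [RHS]big_mkcond /= -(@sum_mirror _ _ (fun j => if P j then l j else 0)).
    by apply: eq_bigr => j _; rewrite PN // ltnW.
  by rewrite l0 -(PN 0) // subn0.
rewrite big_mkcond mul2n -addnn big_split_ord /= mulr2n mulrDl mul1r.
congr (_ + _); rewrite [RHS]big_mkcond //=; apply: eq_bigr => j _.
by rewrite addnC Pm; case: ifP => // Pj; rewrite -periodic.
Qed.

(** Mirror symmetry and period [m] combine into the involution j -> m - j. Its fixed points modulo
    [m], 0 and m/2, contribute 0 and all other terms pair up. *)
Lemma even_sum_coef :
  ~~ odd m -> (P 0 -> sym_coef 0 = 0) -> (P m./2 -> sym_coef m./2 = 0) ->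
  exists k : int, \sum_(j < 2 * m | P j) l j = 2 * k.
Proof.
move=> em s0 sq; pose q := m./2; pose G j := if P j then sym_coef j else 0.
have mq : m = (q + q)%N by rewrite addnn even_halfK.
have Pm' j : (j <= m)%N -> P (m - j)%N = P j.
  by move=> jm; rewrite -Pm -PN; [congr P|]; lia.
have Gm j : (j < m)%N -> G (m - j)%N = G j.
  move=> jm; rewrite /G Pm' ?(ltnW jm) //; case: ifP => // Pj.
  have jn : (j + m <= 2 * m)%N by lia.
  rewrite [RHS](periodic _ jm Pj) -[RHS](sym_coef_mirror _ jn).
  by congr sym_coef; lia.
exists (\sum_(j < q) G j); transitivity (\sum_(j < q + q) G j).
  by rewrite -mq sum_coef_half big_mkcond.
rewrite big_split_ord /= mulr2n mulrDl mul1r; congr (_ + _).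
rewrite -[RHS](@sum_mirror _ _ G) => [|].
  apply: eq_bigr => j _; rewrite -/(G _) -Gm; last by have := ltn_ord j; lia.
  by congr G; lia.
have -> : G 0 = 0 by rewrite /G; case: ifP => // /s0.
by rewrite /G /q; case: ifP => // /sq.
Qed.

End SymmetrizedCoefficients.

Section Relations.
Variables (C : numFieldType) (m : nat) (z : C) (l : nat -> int).
Hypothesis pz : (2 * m).-primitive_root z.
Hypothesis l0 : l 0%N = l (2 * m)%N.
Hypothesis rel : \sum_(j < 2 * m) (l j)%:~R * (z ^+ j + z ^- j) = 0.

Let m0 : (0 < m)%N.
Proof. by have := prim_order_gt0 pz; rewrite muln_gt0. Qed.

Let zm : z ^+ m = -1.
Proof.
have : z ^+ m ^+ 2 == 1 by rewrite -exprM mulnC (prim_expr_order pz).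
rewrite sqrf_eq1 => /orP[|/eqP //].
by rewrite -(prim_order_dvd pz) => /(dvdn_leq m0); lia.
Qed.

(** Replacing z^(-j) by z^(2m - j) collects the coefficients into [sym_coef], and z^m = -1 folds the
    upper half onto the lower one. *)
Lemma sym_coef_relation :
  \sum_(j < m) (sym_coef m l j - sym_coef m l (j + m)%N)%:~R * z ^+ j = 0.
Proof.
transitivity (\sum_(j < 2 * m) (sym_coef m l j)%:~R * z ^+ j).
  rewrite mul2n -addnn big_split_ord /= -big_split /=; apply: eq_bigr => j _.
  by rewrite exprD zm rmorphB addnC; ring.
rewrite -[RHS]rel.
under eq_bigr do rewrite /sym_coef rmorphD mulrDl.
under [RHS]eq_bigr do rewrite mulrDr.
rewrite !big_split /=; congr (_ + _).
rewrite -(@sum_mirror _ _ (fun j => (l j)%:~R * z ^- j)); last first.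
  by rewrite l0 (prim_expr_order pz) expr0.
apply: eq_bigr => j _; congr (_ * _).
have zn0 : z ^+ (2 * m - j) != 0.
  by rewrite expf_neq0 // (primitive_root_neq0 _ _ _ pz).
apply: (mulIf zn0); rewrite mulVf // -exprD subnKC ?(prim_expr_order pz) //.
exact/ltnW.
Qed.

End Relations.

(** * Parity of relation sums for the three forms of n *)

Section Cases.
Variables (C : numFieldType) (z : C) (l : nat -> int).

(** Here the totient of n is m = n/2, so the folded relation is trivial and [sym_coef] has period m.
    Since h > 1, both 0 and m/2 are even and no fixed point lies in the odd class. *)
Lemma even_sum_odd_coef_pow2 (h : nat) :
  (2 * 2 ^ h).-primitive_root z -> (1 < h)%N -> l 0%N = l (2 * 2 ^ h)%N ->
  \sum_(j < 2 * 2 ^ h) (l j)%:~R * (z ^+ j + z ^- j) = 0 ->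
  exists k : int, \sum_(j < 2 * 2 ^ h | odd j) l j = 2 * k.
Proof.
move=> pz h1 l0 rel; set m := (2 ^ h)%N in pz l0 rel *.
have em : ~~ odd m by rewrite oddX; lia.
have eq : ~~ odd m./2.
  by rewrite /m; case: h h1 {m pz l0 rel em} => [|[|h]] // _; rewrite expnS mul2n doubleK oddX.
apply: (@even_sum_coef m l l0 (fun j => odd j)) => //.
- by move=> j; rewrite oddD (negbTE em) addbF.
- by move=> j jn; rewrite oddB // mul2n odd_double.
- move=> j jm _; apply/eqP; rewrite -subr_eq0; apply/eqP.
  apply: (@vanishing_int_sum C _ m z (fun j => sym_coef m l j - sym_coef m l (j + m)%N) pz) => //.
    by rewrite -expnS totient_pfactor //= mul1n.
  exact: sym_coef_relation.
- by rewrite (negbTE eq).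
Qed.

(** Up to sign the folded coefficients depend only on j modulo 2^h. For even j, the Chinese
    remainder theorem finds a multiple of 2p in the same class, where they vanish. *)
Lemma even_sum_even_coef_pow2_prime (h p : nat) :
  prime p -> odd p -> (2 * (2 ^ h * p)).-primitive_root z -> (0 < h)%N ->
  (forall j, (2 * p %| j)%N -> l j = 0) ->
  \sum_(j < 2 * (2 ^ h * p)) (l j)%:~R * (z ^+ j + z ^- j) = 0 ->
  exists k : int, \sum_(j < 2 * (2 ^ h * p) | ~~ odd j) l j = 2 * k.
Proof.
move=> pp op pz h0 lsupp; set m := (2 ^ h * p)%N in pz * => rel.
have [h' hE] : exists h', h = h'.+1 by exists h.-1; lia.
have mE : m = (2 * (2 ^ h' * p))%N by rewrite /m hE expnS mulnA.
have em : ~~ odd m by rewrite mE mul2n odd_double.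
have pm : (2 * p %| m)%N by rewrite mE dvdn_pmul2l // dvdn_mull.
have s0 j : (2 * p %| j)%N -> sym_coef m l j = 0.
  have [jn|jn] := leqP j (2 * m); rewrite /sym_coef => pj.
    by rewrite !lsupp ?addr0 // dvdn_subr // dvdn_mull.
  have -> : (2 * m - j = 0)%N by lia.
  by rewrite !lsupp ?addr0.
have l0 : l 0%N = l (2 * m)%N by rewrite !lsupp // dvdn_mull.
apply: (@even_sum_coef m l l0 (fun j => ~~ odd j)) => //.
- by move=> j; rewrite oddD (negbTE em) addbF.
- by move=> j jn; rewrite oddB // mul2n odd_double.
- move=> j jm ej; apply/eqP; rewrite -subr_eq0; apply/eqP.
  have alt := @vanishing_sum_alternates C h p z
    (fun j => sym_coef m l j - sym_coef m l (j + m)%N) pp op pz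
    (@sym_coef_relation C m z l pz l0 rel).
  have co : coprime (2 ^ h) p by rewrite coprimeXl // coprime2n.
  pose x := (chinese (2 ^ h) p j 0 %% m)%N.
  have m0 : (0 < m)%N by lia.
  have xm : (x < m)%N by rewrite ltn_pmod.
  have xj : (x %% 2 ^ h = j %% 2 ^ h)%N.
    by rewrite /x modn_dvdm ?dvdn_mulr // chinese_modl.
  have xp : (p %| x)%N.
    by rewrite /dvdn /x modn_dvdm ?dvdn_mull // chinese_modr // mod0n.
  have x2 : (2 %| x)%N.
    have h2 : (2 %| 2 ^ h)%N by rewrite hE expnS dvdn_mulr.
    by rewrite /dvdn -(modn_dvdm _ h2) xj modn_dvdm // modn2; case: odd ej.
  have px : (2 * p %| x)%N by rewrite Gauss_dvd ?x2 ?coprime2n.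
  have := alt _ xm; rewrite xj s0 // s0; last by rewrite dvdn_add.
  rewrite subr0 (alt j jm) => /eqP; rewrite eq_sym mulf_eq0 signr_eq0 /= => /eqP ->.
  by rewrite mulr0.
- by move=> _; rewrite s0.
(* The fixed point m/2 is odd when h = 1, and otherwise a multiple of 2p. *)
- have -> : m./2 = (2 ^ h' * p)%N by rewrite mE mul2n doubleK.
  rewrite oddM op andbT oddX => /=; rewrite negb_or -lt0n => eh.
  apply: s0; case: h' {hE mE} eh => // h' _.
  by rewrite expnS -mulnA dvdn_pmul2l // dvdn_mull.
Qed.

(** With blocks of length 1, the vanishing coefficient at 0 forces all folded coefficients to
    vanish, so [sym_coef] has period p. As p is odd, a shift by p exchanges the parity classes and
    both have the same sum. *)
Lemma balanced_sum_coef_prime (p : nat) :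
  prime p -> odd p -> (2 * p).-primitive_root z ->
  (forall j, (p %| j)%N -> l j = 0) ->
  \sum_(j < 2 * p) (l j)%:~R * (z ^+ j + z ^- j) = 0 ->
  \sum_(j < 2 * p | odd j) l j = \sum_(j < 2 * p | ~~ odd j) l j.
Proof.
move=> pp op pz lsupp rel; have p0 := prime_gt0 pp.
have l0 : l 0%N = l (2 * p)%N by rewrite !lsupp // dvdn_mull.
have per j : (j < p)%N -> sym_coef p l j = sym_coef p l (j + p).
  move=> jp; apply/eqP; rewrite -subr_eq0; apply/eqP.
  have alt := @vanishing_sum_alternates C 0 p z
    (fun j => sym_coef p l j - sym_coef p l (j + p)%N) pp op.
  rewrite expn0 !mul1n in alt; have {}alt := alt pz (@sym_coef_relation C p z l pz l0 rel).
  have := alt 0%N p0; rewrite (alt j jp) !modn1 !add0n !div0n expr0 mul1r !divn1 => <-.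
  by rewrite /sym_coef !lsupp ?dvdn0 ?dvdn_sub ?dvdn_mull // subr0 mulr0.
have sumE (b : bool) : \sum_(j < 2 * p | odd j == b) sym_coef p l j =
    \sum_(j < p) sym_coef p l j.
  rewrite big_mkcond mul2n -addnn big_split_ord /= -big_split /=.
  apply: eq_bigr => j _; rewrite addnC oddD op addbT per //.
  by case: (odd j); case: b; rewrite /= ?add0r ?addr0.
have half (b : bool) : \sum_(j < 2 * p | odd j == b) sym_coef p l j =
    2 * \sum_(j < 2 * p | odd j == b) l j.
  rewrite /sym_coef big_split /= mulr2n mulrDl mul1r; congr (_ + _).
  rewrite [LHS]big_mkcond [RHS]big_mkcond /=.
  rewrite -(@sum_mirror _ _ (fun j => if odd j == b then l j else 0)).
    by apply: eq_bigr => j _; rewrite oddB ?(ltnW (ltn_ord j)) // oddM.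
  by rewrite -l0 mul2n odd_double.
apply: (@mulfI _ 2) => //.
rewrite (eq_bigl (fun j : 'I_(2 * p) => odd j == true)); last by move=> j; case: odd.
rewrite [in RHS](eq_bigl (fun j : 'I_(2 * p) => odd j == false)); last by move=> j; case: odd.
by rewrite -!half !sumE.
Qed.

End Cases.

(** The exponents are the total multiplicities of the phases w and -w in a relation. An even sum in
    the class of phase -1 settles w = -1 and w = 1; equal sums settle w = i, because i(-i) = 1. *)
Lemma exists_phase (C : numClosedFieldType) (n a : nat) (z : C) :
  n.-primitive_root z ->
  (exists k : nat, (2 < k)%N /\ n = (2 ^ k)%N) \/
  (exists k p r : nat,
    [/\ (0 < k)%N, prime p, odd p & n = (2 ^ k * p)%N] /\
    (0 < r)%N /\ a%:R = 2 ^ (k%:Z - 2) * r%:R :> rat) ->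
  exists2 w : C, `|w| = 1 & forall l : nat -> int,
    (forall j, (n %/ 2 %| j * a)%N -> l j = 0) ->
    \sum_(j < n) (l j)%:~R * (z ^+ j + z ^- j) = 0 ->
    w ^ (\sum_(j < n | odd j) l j) * (- w) ^ (\sum_(j < n | ~~ odd j) l j) = 1.
Proof.
move=> pz [[k [k2 nE]]|[k [p [r [[k0 pp op nE] [_ aE]]]]]].
  exists (-1) => [|l lsupp rel]; first by rewrite normrN1.
  have nE2 : n = (2 * 2 ^ k.-1)%N by rewrite nE -expnS prednK // (ltn_trans _ k2).
  have l0 : l 0%N = l n by rewrite !lsupp ?mul0n // nE2 mulKn // -mulnA mulnCA dvdn_mulr.
  move: pz l0 rel; rewrite nE2 => pz l0 rel.
  have [|q ->] := even_sum_odd_coef_pow2 _ _ _ _ pz _ l0 rel; first by lia.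
  by rewrite -exprz_exp -exprnP sqrrN expr1n exp1rz opprK exp1rz mulr1.
case: k k0 nE aE => // -[|h] _ nE aE.
  exists 'i => [|l lsupp rel]; first by rewrite normCi.
  move: pz rel lsupp; rewrite nE expn1 mulKn // => pz rel lsupp.
  rewrite (balanced_sum_coef_prime _ _ _ _ pp op pz _ rel); last first.
    by move=> j pj; apply: lsupp; rewrite dvdn_mulr.
  by rewrite -expfzMl mulrN -expr2 sqrCi opprK exp1rz.
have {}aE : a = (2 ^ h * r)%N.
  apply/eqP; rewrite -(eqr_nat rat) aE natrM natrX.
  by rewrite (_ : h.+2%:Z - 2 = h%:Z) // -!natz; lia.
exists 1 => [|l lsupp rel]; first by rewrite normr1.
have nE2 : n = (2 * (2 ^ h.+1 * p))%N by rewrite nE mulnA -expnS.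
move: pz rel lsupp; rewrite nE2 mulKn // => pz rel lsupp.
have [|//|q ->] := even_sum_even_coef_pow2_prime _ _ _ _ _ pp op pz _ _ rel.
- by [].
- move=> j /dvdnP[t ->]; apply: lsupp; apply/dvdnP; exists (t * r)%N.
  by rewrite aE expnS; ring.
by rewrite exp1rz mul1r -exprz_exp -exprnP sqrrN expr1n exp1rz.
Qed.

(** * Simultaneous approximation of the phases *)

Lemma cisN (R : realType) (x : R) : cis R (- x) = (cis R x)^-1.
Proof.
have c0 : cis R x != 0 by rewrite -normr_eq0 norm_cis oner_eq0.
by apply: (mulIf c0); rewrite mulVf // -cisD addNr cis0.
Qed.

(** A smaller order k would give cos(2y) = 1 for y = pi k / n, although sin y > 0. *)
Lemma cis_primitive_root (R : realType) (n : nat) :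
  (0 < n)%N -> n.-primitive_root (cis R (2 * pi / n%:R)).
Proof.
move=> n0; have nR : 0 < n%:R :> R by rewrite ltr0n.
set x := 2 * pi / n%:R.
have zn : cis R x ^+ n = 1.
  by rewrite -cisMn -mulr_natr mulfVK ?lt0r_neq0 // /cis mulr_natl cos2pi sin2pi.
have [k pk kn] := prim_order_exists n0 zn.
have k0 := prim_order_gt0 pk.
suff -> : n = k by [].
apply/eqP; rewrite eqn_leq (dvdn_leq n0 kn) andbT leqNgt; apply/negP => ltkn.
pose y : R := pi * (k%:R / n%:R).
have kR : 0 < k%:R :> R by rewrite ltr0n.
have siny : 0 < sin y.
  apply: sin_gt0_pi; rewrite mulr_gt0 ?pi_gt0 ?divr_gt0 //=.
  by rewrite gtr_pMr ?pi_gt0 // ltr_pdivrMr // mul1r ltr_nat.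
have := prim_expr_order pk; rewrite -cisMn => -[+ _].
have -> : x *+ k = y *+ 2 by rewrite /x /y -mulr_natr; ring.
rewrite cos_mulr2n => cos1; have := cos2Dsin2 y.
have : 0 < sin y ^+ 2 by rewrite exprn_gt0.
by lra.
Qed.

Lemma cisDV (R : realType) (x : R) : cis R x + (cis R x)^-1 = (2 * cos x)%:C%C.
Proof.
rewrite -cisN /cis cosN sinN; apply/eqP; rewrite eq_complex /= addrN eqxx andbT.
by rewrite mulr_natl.
Qed.

Lemma phase_approximation (R : realType) (n a : nat) :
  (0 < n)%N ->
  (exists k : nat, (2 < k)%N /\ n = (2 ^ k)%N) \/
  (exists k p r : nat,
    [/\ (0 < k)%N, prime p, odd p & n = (2 ^ k * p)%N] /\
    (0 < r)%N /\ a%:R = 2 ^ (k%:Z - 2) * r%:R :> rat) ->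
  exists w : R[i], forall eps : R, 0 < eps -> exists t : R,
    forall j : 'I_n, ~~ (n %/ 2 %| j * a)%N ->
      `|cis R (t * (2 * cos ((2 * pi / n%:R) *+ j))) - (if odd j then w else - w)|
        < eps%:C%C.
Proof.
move=> n0 hcase; have pz := cis_primitive_root R n n0.
set x := 2 * pi / n%:R in pz *.
have [w w1 hw] := exists_phase _ _ _ _ pz hcase; exists w => eps eps0.
pose off (j : 'I_n) := (n %/ 2 %| j * a)%N.
(* Indices outside the support of the source get frequency 0 and phase 1, so they impose no
   condition; index 0 is one of them and serves as the base index. *)
pose th (j : 'I_n) := if off j then 0 else 2 * cos (x *+ j).
pose tau (j : 'I_n) := if off j then 1 else if odd j then w else - w.
have w0 : w != 0 by rewrite -normr_eq0 w1 oner_eq0.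
have tau0 j : tau j != 0.
  by rewrite /tau; case: ifP => _; rewrite ?oner_eq0 //; case: ifP; rewrite ?oppr_eq0.
pose i0 := Ordinal n0; have off0 : off i0 by rewrite /off mul0n dvdn0.
have [||||t ht] := kronecker R _ i0 th tau eps eps0.
- by rewrite /th off0.
- by rewrite /tau off0.
- by move=> j; rewrite /tau; case: (off j); [rewrite normr1|case: odd; rewrite ?normrN].
- move=> c c' ec.
  pose lI (j : 'I_n) : int := if off j then 0 else (c j)%:Z - (c' j)%:Z.
  pose l (j : nat) : int := if insub j is Some i then lI i else 0.
  have lE (j : 'I_n) : l j = lI j by rewrite /l valK.
  have lsupp j : (n %/ 2 %| j * a)%N -> l j = 0.
    by rewrite /l; case: insubP => // i _ <- oj; rewrite /lI /off oj.
  have lrel : \sum_(j < n) (l j)%:~R * (cis R x ^+ j + cis R x ^- j) = 0.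
    rewrite (eq_bigr (fun j => (th j *+ c j - th j *+ c' j)%:C%C)) => [|j _].
      by rewrite -(rmorph_sum (real_complex R)) sumrB ec subrr.
    rewrite -cisMn cisDV lE /lI /th; case: ifP => _.
      by rewrite !mul0rn subrr mul0r.
    by rewrite rmorphB /= mulrBl rmorphB !rmorphMn /= !mulr_natl.
  have := hw l lsupp lrel.
  set O := \sum_(j < n | odd j) _; set E := \sum_(j < n | ~~ odd j) _ => OE.
  have h : \prod_j tau j ^ (l j) = 1.
    rewrite -[RHS]OE (bigID (fun j : 'I_n => odd j)) /=; congr (_ * _).
      rewrite /O (big_morph (exprz w) (fun i j => expfzDr i j w0) (expr0z w)).
      apply: eq_bigr => j oj; rewrite lE /tau /lI oj.
      by case: (off j); rewrite ?expr0z.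
    have nw0 : - w != 0 by rewrite oppr_eq0.
    rewrite /E (big_morph (exprz (- w)) (fun i j => expfzDr i j nw0) (expr0z (- w))).
    apply: eq_bigr => j oj; rewrite lE /tau /lI (negbTE oj).
    by case: (off j); rewrite ?expr0z.
  rewrite -[RHS]mul1r -[X in _ = X * _]h -big_split /=; apply: eq_bigr => j _.
  rewrite lE /lI /tau; case: ifP => oj; first by rewrite !expr1n expr0z mulr1.
  have := tau0 j; rewrite /tau oj => tj.
  by rewrite [LHS]exprnP [X in _ = _ * X]exprnP -expfzDr // subrK.
exists t => j nj; have := ht j; rewrite /th /tau.
by have -> : off j = false by exact/negbTE.
Qed.

(** * Spectrum of the signed cycle *)

Section SignedCycle.
Variables (R : realType) (q : nat).
Local Notation n := q.+2.
Local Notation m := (n %/ 2)%N.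
Hypothesis q0 : (0 < q)%N.
Hypothesis even_n : ~~ odd n.

Let mE : n = (2 * m)%N.
Proof. by rewrite mulnC divnK // dvdn2. Qed.

Let m2 : (2 <= m)%N.
Proof. by move: q0 even_n mE => /=; lia. Qed.

Lemma val_Zp_succ (x : 'Z_n) : (x + 1 : 'Z_n) = (if x.+1 == n then 0 else x.+1)%N :> nat.
Proof.
have xn : (x < n)%N := ltn_ord x.
rewrite /= ?modn_mod ?modnDmr addn1; case: eqVneq => [->|ne]; first by rewrite modnn.
by rewrite modn_small // ltn_neqAle ne.
Qed.

Lemma eq_set2 (T : finType) (a b c d : T) :
  ([set a; b] == [set c; d]) = ((a == c) && (b == d)) || ((a == d) && (b == c)).
Proof.
apply/eqP/orP => [e|[/andP[/eqP-> /eqP->] //|/andP[/eqP-> /eqP->]]]; last first.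
  by rewrite finset.setUC.
have /finset.setP ee := e.
have := ee a; have := ee b; have := ee c; have := ee d.
rewrite !inE !eqxx /= !orbT [c == a]eq_sym [c == b]eq_sym [d == a]eq_sym [d == b]eq_sym.
by case: (a == c); case: (b == d); case: (a == d); case: (b == c) => //=; auto.
Qed.

(* Switching at the vertices above n/2 turns the signed cycle into the
   unsigned one. *)
Definition switching (K : nzRingType) (x : 'Z_n) : K := if (x <= m)%N then 1 else -1.

(** The switch changes sign only from n/2 to n/2 + 1 and from n - 1 to 0, exactly along the two
    negative edges. *)
Lemma switching_succ (K : nzRingType) (x : 'Z_n) :
  (if negative_edge x (x + 1) then -1 else 1) = switching K x * switching K (x + 1).
Proof.
have xn : (x < n)%N := ltn_ord x.
have vE (k : nat) : (k < n)%N -> (k%:R : 'Z_n) = k :> nat.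
  by move=> kn; rewrite val_Zp_nat // modn_small.
have mn : (m + 1 < n)%N by lia.
rewrite /negative_edge !eq_set2 -!val_eqE [val (x + 1)]val_Zp_succ.
rewrite [val ((n - 1)%N%:R : 'Z_n)]vE; last by lia.
rewrite [val (m%:R : 'Z_n)]vE; last by lia.
rewrite [val ((m + 1)%N%:R : 'Z_n)]vE //.
rewrite /switching val_Zp_succ -[\val x]/(x : nat) -[val (0 : 'Z_n)]/0%N.
case: (eqVneq x.+1 n) => xe.
  have -> : (x <= m)%N = false by lia.
  have -> : x = (n - 1)%N :> nat by lia.
  by rewrite !eqxx /= ?orbT mulr1.
case: (eqVneq (x : nat) m) => xm.
  have -> : (x <= m)%N by lia.
  have -> : (x.+1 <= m)%N = false by lia.
  have -> : x.+1 = (m + 1)%N by lia.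
  by rewrite !eqxx /= ?orbT mul1r.
have -> : (x.+1 <= m)%N = (x <= m)%N by lia.
transitivity (1 : K); first by case: ifP => // h; exfalso; lia.
by case: ifP; rewrite ?mul1r ?mulrNN ?mulr1.
Qed.

Lemma signed_cycle_adjE (x y : 'Z_n) :
  signed_cycle_adj R n x y = (cycle_edge x y)%:R * (switching R x * switching R y).
Proof.
have negC u v : negative_edge u v = negative_edge v u by rewrite /negative_edge finset.setUC.
rewrite mxE /cycle_edge; case: eqVneq => [->|_] /=; first by rewrite mul1r switching_succ.
case: eqVneq => [->|_] /=; last by rewrite mul0r.
by rewrite mul1r negC switching_succ mulrC.
Qed.

Lemma sum_cycle_neighbors (K : nzRingType) (f : 'Z_n -> K) (x : 'Z_n) :
  \sum_y (cycle_edge x y)%:R * f y = f (x + 1) + f (x - 1).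
Proof.
(* The two neighbours differ because n > 2. *)
have ne : x + 1 != x - 1.
  apply/eqP => /addrI /eqP; rewrite -addr_eq0 -val_eqE /=.
  by rewrite !modn_small // addn1 modn_small.
rewrite (bigD1 (x + 1)) //= (bigD1 (x - 1)) /=; last by rewrite eq_sym.
rewrite /cycle_edge eqxx mul1r subrK eqxx orbT mul1r big1 ?addr0 // => y /andP[y1 y2].
rewrite (negbTE y1) /=; case: eqVneq => [e|_]; last by rewrite mul0r.
by move: y2; rewrite e addrK eqxx.
Qed.

End SignedCycle.

(** * Spectral decomposition of the transition matrix *)

Section Spectral.
Variables (R : realType) (q : nat).
Local Notation n := q.+2.
Local Notation m := (n %/ 2)%N.
Local Notation C := R[i]^o.
Hypothesis q0 : (0 < q)%N.
Hypothesis even_n : ~~ odd n.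

Let z : C := cis R (2 * pi / n%:R).

Let pz : n.-primitive_root z.
Proof. exact: cis_primitive_root. Qed.

Let zj0 (j : nat) : z ^+ j != 0.
Proof. by rewrite expf_neq0 // (primitive_root_neq0 _ _ _ pz). Qed.

Let zjn (j : nat) : z ^+ j ^+ n = 1.
Proof. by rewrite -exprM mulnC exprM (prim_expr_order pz) expr1n. Qed.

Let sg (x : 'Z_n) : C := switching q C x.

Let sg2 x : sg x * sg x = 1.
Proof. by rewrite /sg /switching; case: ifP; rewrite ?mulrNN mulr1. Qed.

(** The orthogonal projector onto the line of the [j]-th character of Z_n multiplied by the switch;
    dividing by a power of [z] is conjugation. *)
Definition projector (j : 'I_n) : 'M[C]_n :=
  \matrix_(x, y) (n%:R^-1 * (sg x * sg y) * (z ^+ j ^+ x / z ^+ j ^+ y)).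

Lemma projector_sum : \sum_j projector j = 1.
Proof.
apply/matrixP => x y; rewrite summxE !mxE.
under eq_bigr do rewrite mxE; rewrite -mulr_sumr.
set r : C := z ^+ x / z ^+ y.
rewrite (eq_bigr (fun j : 'I_n => r ^+ j)) => [|j _]; last first.
  by rewrite expr_div_n -!exprM mulnC [(j * y)%N]mulnC.
have nC : n%:R != 0 :> C by rewrite pnatr_eq0.
case: eqVneq => [e|ne].
  rewrite (eq_bigr (fun=> 1)) => [|j _]; last by rewrite /r e divff // expr1n.
  by rewrite e sg2 mulr1 sumr_const card_ord mulVf.
suff -> : \sum_(j < n) r ^+ j = 0 by rewrite mulr0.
have r1 : r - 1 != 0.
  rewrite subr_eq0; apply: contra ne => /eqP re.
  have : z ^+ x == z ^+ y by rewrite -[z ^+ x](divfK (zj0 y)) -/r re mul1r.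
  rewrite (eq_prim_root_expr pz) !modn_small ?ltn_ord //.
apply: (mulfI r1); rewrite -subrX1 mulr0 expr_div_n.
by rewrite !zjn divr1 subrr.
Qed.

Let exp_succ (j : nat) (x : 'Z_n) : z ^+ j ^+ (x + 1)%R = z ^+ j ^+ x * z ^+ j.
Proof.
rewrite -exprSr val_Zp_succ; case: eqVneq => // ->.
by rewrite zjn.
Qed.

(** In the product with the adjacency matrix the inner signs square to 1, and summing a character
    over the two neighbours multiplies it by z^j + z^(-j). *)
Lemma transition_projector (t : R) :
  transition_mx (signed_cycle_adj R n) t =
  \sum_(j < n) (cis R (t * (2 * cos ((2 * pi / n%:R) *+ j))) : C) *: projector j.
Proof.
apply: (exp_mx_spectral _ _ _ _ _ _ projector_sum) => j.
rewrite -scalerAl; have -> : (Complex 0 (t * (2 * cos ((2 * pi / n%:R) *+ j))) : C) =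
    Complex 0 t * (z ^+ j + z ^- j).
  rewrite -cisMn cisDV; move: (2 * cos _) => c; apply/eqP; rewrite eq_complex /=.
  by apply/andP; split; apply/eqP; ring.
rewrite -scalerA; congr (_ *: _); apply/matrixP => x y.
have swE (u : 'Z_n) : real_complex R (switching q R u) = sg u.
  by rewrite /sg /switching; case: ifP; rewrite ?rmorphN rmorph1.
rewrite [LHS]mxE (eq_bigr (fun w => (@cycle_edge n x w)%:R *
     (n%:R^-1 * (sg x * sg y) / z ^+ j ^+ y * z ^+ j ^+ w) : C)) => [|w _]; last first.
  rewrite [map_mx _ _ _ _]mxE signed_cycle_adjE // [projector j w y]mxE.
  rewrite !(rmorphM (real_complex R)) /= rmorph_nat !swE.
  transitivity (((@cycle_edge n x w)%:R : C) * ((sg w * sg w) *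
    (n%:R^-1 * (sg x * sg y) / z ^+ j ^+ y * z ^+ j ^+ w))); last by rewrite sg2 mul1r.
  by ring.
rewrite (sum_cycle_neighbors _ q0 _ _ x) exp_succ.
have -> : z ^+ j ^+ (x - 1)%R = z ^+ j ^+ x * z ^- j.
  by rewrite -[in RHS](subrK 1 x) exp_succ mulfK.
rewrite !mxE; ring.
Qed.

Lemma projector_pair_state (j : 'I_n) (a b : 'Z_n) (x : 'Z_n) :
  (projector j *m pair_state R a b) x 0 =
  real_complex R (Num.sqrt 2)^-1 * (n%:R^-1 * sg x * z ^+ j ^+ x) *
    (sg a / z ^+ j ^+ a + sg b / z ^+ j ^+ b).
Proof.
rewrite /pair_state /std_basis -scalemxAr mulmxDr -!colE !mxE.
by rewrite -[RHS]mulrA; congr (_ * _); ring.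
Qed.

End Spectral.

(** * Spectral components of the source and target *)

Section Transfer.
Variables (R : realType) (q a : nat).
Local Notation n := q.+2.
Local Notation m := (n %/ 2)%N.
Local Notation C := R[i]^o.
Hypothesis q0 : (0 < q)%N.
Hypothesis even_n : ~~ odd n.
Hypothesis a0 : (0 < a)%N.
Hypothesis am : (a < m)%N.

Let mE : n = (2 * m)%N.
Proof. by rewrite mulnC divnK // dvdn2. Qed.

Let z : C := cis R (2 * pi / n%:R).

Let pz : n.-primitive_root z.
Proof. exact: cis_primitive_root. Qed.

Let source : 'cV[C]_n := pair_state R (a%:R : 'Z_n) ((n - a)%N%:R : 'Z_n).
Let target : 'cV[C]_n := pair_state R ((m - a)%N%:R : 'Z_n) ((m + a)%N%:R : 'Z_n).

Let vE (k : nat) : (k < n)%N -> (k%:R : 'Z_n) = k :> nat.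
Proof. by move=> kn; rewrite val_Zp_nat // modn_small. Qed.

(** The two vertices lie on opposite sides of the switch, so the sum of basis vectors is seen by the
    characters as a difference. *)
Let mirror_amplitude (j : 'I_n) (b b' : 'Z_n) (x : 'Z_n) :
  (b < m)%N -> (m < b')%N -> z ^+ j ^+ b' = (z ^+ j ^+ b)^-1 ->
  (projector R q j *m pair_state R b b') x 0 =
  real_complex R (Num.sqrt 2)^-1 * (n%:R^-1 * switching q C x * z ^+ j ^+ x) *
    ((z ^+ j ^+ b)^-1 - z ^+ j ^+ b).
Proof.
move=> bm bm' e; rewrite projector_pair_state -/z.
have -> : switching q C b = 1 by rewrite /switching ltnW.
have -> : switching q C b' = -1 by rewrite /switching leqNgt bm'.
by rewrite e invrK mul1r mulN1r.
Qed.

Let inv_exp (y : C) (k : nat) : y ^+ n = 1 -> (k <= n)%N -> y ^+ (n - k) = (y ^+ k)^-1.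
Proof.
move=> yn kn; have y0 : y ^+ k != 0.
  by rewrite expf_neq0 //; apply: contra_eq_neq yn => ->; rewrite expr0n eq_sym oner_eq0.
by apply: (mulIf y0); rewrite -exprD subnK // yn mulVf.
Qed.

Let zjn (j : nat) : z ^+ j ^+ n = 1.
Proof. by rewrite -exprM mulnC exprM (prim_expr_order pz) expr1n. Qed.

Let zjm (j : nat) : z ^+ j ^+ m = (-1) ^+ j.
Proof.
have zm : z ^+ m = -1.
  have : z ^+ m ^+ 2 == 1 by rewrite -exprM mulnC -mE (prim_expr_order pz).
  rewrite sqrf_eq1 => /orP[|/eqP //].
  by rewrite -(prim_order_dvd pz) => /(dvdn_leq (leq_ltn_trans (leq0n a) am)); lia.
by rewrite -exprM mulnC exprM zm.
Qed.

Let source_amplitude (j : 'I_n) (x : 'Z_n) :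
  (projector R q j *m source) x 0 =
  real_complex R (Num.sqrt 2)^-1 * (n%:R^-1 * switching q C x * z ^+ j ^+ x) *
    ((z ^+ j ^+ a)^-1 - z ^+ j ^+ a).
Proof.
have an : (a < n)%N by lia.
have nan : (n - a < n)%N by lia.
rewrite mirror_amplitude ?vE //; first by lia.
by rewrite inv_exp // ltnW.
Qed.

(** Since z^(jm) = (-1)^j, passing from a to m - a inverts z^(ja) up to this sign, and inversion
    negates the amplitude. *)
Lemma projector_source_target (j : 'I_n) :
  projector R q j *m target = - (-1) ^+ j *: (projector R q j *m source).
Proof.
apply/matrixP => x y; rewrite ord1 [RHS]mxE source_amplitude.
have man : (m - a < n)%N by lia.
have pan : (m + a < n)%N by lia.
have e : z ^+ j ^+ (m - a) = (-1) ^+ j * (z ^+ j ^+ a)^-1.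
  rewrite -zjm -inv_exp ?zjn //; last by lia.
  rewrite -exprD; have -> : (m + (n - a) = n + (m - a))%N by lia.
  by rewrite exprD zjn mul1r.
have e2 : ((-1) ^+ j : C)^-1 = (-1) ^+ j by rewrite -exprVn invrN1.
rewrite mirror_amplitude ?vE //; try lia; last first.
  by rewrite exprD zjm e invfM invrK e2.
by rewrite e invfM invrK e2; ring.
Qed.

(** Here z^(ja) is a sign, equal to its own inverse, so the amplitude cancels. *)
Lemma projector_source_eq0 (j : 'I_n) :
  (m %| j * a)%N -> projector R q j *m source = 0.
Proof.
move=> /dvdnP[k kE]; apply/matrixP => x y; rewrite ord1 source_amplitude [RHS]mxE.
have -> : z ^+ j ^+ a = (-1) ^+ k.
  by rewrite -exprM kE mulnC exprM -(expr1 z) zjm expr1.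
by rewrite -exprVn invrN1 subrr mulr0.
Qed.

End Transfer.

(** * Passage to the limit *)

Section Limit.
Local Open Scope classical_set_scope.

Lemma cvg_of_dist_inv (R : realType) (u : nat -> R[i]^o) (l : R[i]^o) :
  (forall k, `|u k - l| < (k.+1%:R^-1)%:C%C) -> u @ \oo --> l.
Proof.
move=> ul; apply/cvgrPdist_lt => e e0.
have [er ee er0] : exists2 r, e = r%:C%C & 0 < r.
  have /complex_realP[r er] : e \is Num.real by rewrite realE ltW.
  by exists r => //; rewrite -ltcR -er.
near=> k; rewrite distrC ee; apply: lt_trans (ul k) _; rewrite ltcR.
by near: k; exact: (near_infty_natSinv_lt (PosNum er0)).
Unshelve. all: by end_near. Qed.

Lemma signed_cycle_transfer (R : realType) (q a : nat) (w : R[i]) (tau : nat -> R) :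
  (0 < q)%N -> ~~ odd q.+2 -> (0 < a)%N -> (a < q.+2 %/ 2)%N ->
  (forall (k : nat) (j : 'I_q.+2), ~~ (q.+2 %/ 2 %| j * a)%N ->
     `|cis R (tau k * (2 * cos ((2 * pi / q.+2%:R) *+ j))) - (if odd j then w else - w)|
       < (k.+1%:R^-1)%:C%C) ->
  (transition_mx (signed_cycle_adj R q.+2) (tau k) *m
     pair_state R (a%:R : 'Z_q.+2) ((q.+2 - a)%N%:R : 'Z_q.+2) @[k --> \oo]) -->
  ((w : R[i]^o) *:
     pair_state R ((q.+2 %/ 2 - a)%N%:R : 'Z_q.+2) ((q.+2 %/ 2 + a)%N%:R : 'Z_q.+2)).
Proof.
move=> q0 even_n a0 am htau.
set u := pair_state R (a%:R : 'Z_q.+2) _; set v := pair_state R _ _.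
(* The phases w for odd j and -w for even j absorb the sign between the components of [u] and [v],
   so the limit can be taken component by component. *)
have -> : (w : R[i]^o) *: v = \sum_(j < q.+2)
    ((if odd j then w else - w) : R[i]^o) *: (projector R q j *m u).
  rewrite -[in LHS](mul1mx v) -[1%:M]/(1 : 'M[R[i]^o]_q.+2) -(projector_sum R q).
  rewrite mulmx_suml scaler_sumr; apply: eq_bigr => j _.
  rewrite projector_source_target // scalerA -signr_odd.
  by case: odd; rewrite ?expr1 ?expr0 ?opprK ?mulr1 ?mulrN1.
have uE k : transition_mx (signed_cycle_adj R q.+2) (tau k) *m u = \sum_(j < q.+2)
    (cis R (tau k * (2 * cos ((2 * pi / q.+2%:R) *+ j))) : R[i]^o) *: (projector R q j *m u).
  rewrite transition_projector // mulmx_suml.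
  by apply: eq_bigr => j _; rewrite -scalemxAl.
rewrite (funext uE); apply: cvg_sum_fin => j.
have [off|on] := boolP (q.+2 %/ 2 %| j * a)%N.
  rewrite projector_source_eq0 // scaler0.
  by under eq_fun do rewrite scaler0; exact: cvg_cst.
by apply: cvgZr_tmp; apply: cvg_of_dist_inv => k; exact: htau.
Qed.

End Limit.

Theorem theorem8p1 (R : realType) (n a : nat)
    (hn : (2 < n)%N) (hn_even : ~~ odd n)
    (ha : (0 < a < n %/ 2)%N) (ha_quarter : (4 * a)%N <> n)
    (hcase :
      (exists k : nat, (2 < k)%N /\ n = (2 ^ k)%N) \/
      (exists k p r : nat,
        [/\ (0 < k)%N, prime p, odd p & n = (2 ^ k * p)%N] /\
        (0 < r)%N /\ a%:R = 2 ^ (k%:Z - 2) * r%:R :> rat)) :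
  pretty_good_state_transfer (signed_cycle_adj R n)
    (pair_state R (a%:R : 'Z_n) ((n - a)%N%:R : 'Z_n))
    (pair_state R ((n %/ 2 - a)%N%:R : 'Z_n) ((n %/ 2 + a)%N%:R : 'Z_n)).
Proof.
case: n hn hn_even ha ha_quarter hcase => [//|[//|q]] q0 even_n /andP[a0 am] _ hcase.
have [w hw] := phase_approximation R q.+2 a isT hcase.
(* One phase [w] serves all tolerances, so the times for 1/(k+1) form the required sequence with
   [gamma] = [w]. *)
have /choice[tau htau] : forall k : nat, exists t : R, forall j : 'I_q.+2,
    ~~ (q.+2 %/ 2 %| j * a)%N ->
    `|cis R (t * (2 * cos ((2 * pi / q.+2%:R) *+ j))) - (if odd j then w else - w)|
      < (k.+1%:R^-1)%:C%C.
  by move=> k; apply: hw; rewrite invr_gt0 ltr0n.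
exists tau, w; exact: signed_cycle_transfer.
Qed.
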